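(* Let $H$ be a separable infinite-dimensional complex Hilbert space, $L$ a normal (specifically, self-adjoint) unbounded linear operator in $H$ with resolution of the identity (spectral measure) $E=E(\delta)$, $\delta\in\mathcal{B}(\mathbb{C})$, and let $N$ be a normed space such that $N$ and $H$ are embedded algebraically in a certain linear space. Let $R$ and $S$ be bounded linear operators on (the whole of) $H$ such that they are commutative with $L$ and that $R$ is a bounded operator from $H$ to $N$. Then the spectral expansion $f=\int_{\mathbb{C}}dEf$ converges unconditionally in the space $N$ at every vector $f\in RS(H)$. Moreover, the degree of this convergence admits the estimate $$\|f-E(\delta)f\|_N\le\|R\|_{H\to N}\cdot\|g\|\cdot\|S(I-E(\delta))\|_{H\to H}\cdot r_g(\delta)$$ for every $\delta\in\mathcal{B}(\mathbb{C})$ and with some decreasing function $r_g(\delta)\in[0,1]$ of $\delta\in\mathcal{B}(\mathbb{C})$ such that $r_g(\widetilde{B}_\lambda)\to0$ as $\lambda\to\infty$. Here $g\in H$ is an arbitrary vector satisfying $f=RSg$, and the function $r_g(\delta)$ does not depend on $S$ and $R$.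
   Context: $\mathcal{B}(\mathbb{C})$ is the class of all Borel subsets of $\mathbb{C}$; $\widetilde{B}_\lambda:=\{z\in\mathbb{C}:|z|\le\lambda\}$ for $\lambda>0$; $I$ is the identity operator on $H$; $\|\cdot\|$ is the norm in $H$ and $\|\cdot\|_N$ is the norm in $N$; $\|\cdot\|_{H\to N}$ and $\|\cdot\|_{H\to H}$ are the norms of bounded linear operators from $H$ to $N$ and on $H$, respectively. ''Decreasing function of $\delta$'' refers to set inclusion, in the nonstrict sense: $\delta_1\subseteq\delta_2$ implies $r_g(\delta_1)\ge r_g(\delta_2)$. Unconditional convergence: for $f\in H$, the expansion $f=\int_{\mathbb{C}}dEf$ converges unconditionally in $N$ at $f$ if $E(\delta)f\in N$ whenever $\delta\in\mathcal{B}(\mathbb{C})$ and if for every $\varepsilon>0$ there exists a bounded set $\gamma=\gamma(\varepsilon)\in\mathcal{B}(\mathbb{C})$ such that $\|f-E(\delta)f\|_N<\varepsilon$ whenever $\gamma\subseteq\delta\in\mathcal{B}(\mathbb{C})$. Commutativity: if $T$ is a bounded linear operator on $H$ and $M$ is an unbounded linear operator in $H$, the phrase ''$T$ is commutative with $M$'' means that $TMf=MTf$ for every vector $f\in(\mathrm{Dom}\,M)\cap\mathrm{Dom}(MT)$.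
   Formalization: R and S are additionally assumed to map Dom L into itself (so RL ⊆ LR and SL ⊆ LS); with commutativity only on Dom M ∩ Dom(MT) the claim fails, e.g. L = diag(n) on l², R = I, Sf = (f,e₁)v with v = (1/n) not in Dom L. *)

(* Defs.v *)
From HB Require Import structures.
From mathcomp Require Import all_boot all_order all_algebra.
From mathcomp Require Import complex.
From mathcomp Require Import all_classical all_reals all_analysis.

Set Implicit Arguments.
Unset Strict Implicit.
Unset Printing Implicit Defensive.

Import Order.TTheory GRing.Theory Num.Theory numFieldNormedType.Exports.

Local Open Scope classical_set_scope.
Local Open Scope ring_scope.

(* The norm of a complex normed space takes its values in K[i] (they are real
   and nonnegative there); [nrm] is the same norm with values in K. *)
Definition nrm (K : realType) (U : normedZmodType K[i]) (x : U) : K :=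
  complex.Re `|x|.

(* The complex plane with its Borel sigma-algebra; [K[i]^o] carries the topology
   of the modulus. *)
Notation borelC K := (g_sigma_algebraType (@open (K[i])^o)).

Definition borel (K : realType) (A : set K[i]) : Prop :=
  measurable (A : set (borelC K)).

Definition disk (K : realType) (lambda : K) : set K[i] :=
  [set z | nrm z <= lambda].

(* An inner product, linear in its first argument, inducing the norm of [H];
   completeness comes from the type of [H]. *)
Record inner_product (K : realType) (H : completeNormedModType K[i]) :=
  InnerProduct {
    ip_form :> {dot H for (@Num.conj K[i])};
    ip_norm : forall x : H, `|x| ^+ 2 = ip_form x x }.

Definition separable (T : topologicalType) : Prop :=
  exists2 D : set T, countable D & dense D.

Definition infinite_dimensional (F : fieldType) (U : lmodType F) : Prop :=
  forall (n : nat) (e : 'I_n -> U),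
    exists x : U, forall c : 'I_n -> F, x <> \sum_(i < n) c i *: e i.

Section operators.
Context (K : realType) (H : completeNormedModType K[i]).
Context (ip : inner_product H).

(* A linear operator in H with its domain; the values of [op_fun] outside
   [op_dom] are irrelevant. *)
Record operator := Operator {
  op_dom : set H;
  op_fun :> H -> H;
  op_dom0 : op_dom 0;
  op_domP : forall (a : K[i]) (x y : H), op_dom x -> op_dom y ->
    op_dom (a *: x + y);
  op_linear : forall (a : K[i]) (x y : H), op_dom x -> op_dom y ->
    op_fun (a *: x + y) = a *: op_fun x + op_fun y }.

Definition bounded_op (T : H -> H) : Prop :=
  exists M : K, forall x, nrm (T x) <= M * nrm x.

Definition unbounded (L : operator) : Prop :=
  ~ exists M : K, forall x, op_dom L x -> nrm (L x) <= M * nrm x.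

Definition graph (L : operator) : set (H * H) :=
  [set p | op_dom L p.1 /\ p.2 = L p.1].

(* The graph of the adjoint (a function when [op_dom L] is dense). *)
Definition adjoint_graph (L : operator) : set (H * H) :=
  [set p | forall x, op_dom L x -> ip (L x) p.1 = ip x p.2].

(* The graph of the product AB, with its natural domain. *)
Definition graph_mul (A B : set (H * H)) : set (H * H) :=
  [set p | exists2 y, B (p.1, y) & A (y, p.2)].

Definition normal_operator (L : operator) : Prop :=
  [/\ dense (op_dom L), closed (graph L) &
      graph_mul (adjoint_graph L) (graph L) =
      graph_mul (graph L) (adjoint_graph L)].

Record spectral_measure := SpectralMeasure {
  sm_proj :> set K[i] -> {linear H -> H};
  sm_selfadjoint : forall A x y, borel A ->
    ip (sm_proj A x) y = ip x (sm_proj A y);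
  sm_mul : forall A B x, borel A -> borel B ->
    sm_proj (A `&` B) x = sm_proj A (sm_proj B x);
  sm_set0 : forall x, sm_proj set0 x = 0;
  sm_setT : forall x, sm_proj setT x = x;
  sm_sigma_additive : forall (A : nat -> set K[i]) x,
    (forall i, borel (A i)) -> trivIset setT A ->
    \sum_(0 <= i < n) sm_proj (A i) x @[n --> \oo]
      --> sm_proj (\bigcup_i A i) x }.

End operators.

Section spectral_distribution.
Context (K : realType) (H : completeNormedModType K[i]).
Context (ip : inner_product H) (E : spectral_measure ip) (x : H).

(* The measure (E(A)x, x) = ||E(A)x||^2, nonnegative on all sets. *)
Definition spectral_distribution (A : set (borelC K)) : \bar K :=
  (nrm (E A x) ^+ 2)%:E.

Lemma nrmE (y : H) : ((nrm y)%:C)%C = `|y|.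
Proof.
have : 0 <= `|y| :> K[i] by [].
rewrite /nrm; case: `|y| => a b /=.
by rewrite lecE /= => /andP[/eqP -> _].
Qed.

Lemma nrm_ge0 (y : H) : 0 <= nrm y.
Proof.
have : 0 <= `|y| :> K[i] by [].
by rewrite -nrmE lecR.
Qed.

Lemma nrm_sqr (y : H) : ((nrm y ^+ 2)%:C)%C = ip y y.
Proof. by rewrite -ip_norm -nrmE rmorphXn. Qed.

Lemma cvg_nrm (u : nat -> H) (l : H) :
  u @ \oo --> l -> nrm (u n) @[n --> \oo] --> nrm l.
Proof.
move=> ul; apply/cvgrPdist_lt => e e0.
have ec : 0 < (e%:C)%C :> K[i] by rewrite ltcR.
have := ul => /cvgrPdist_lt /(_ _ ec).
apply: filterS => n h.
have := le_lt_trans (ler_dist_dist l (u n)) h.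
rewrite -!nrmE -rmorphB /= normc_def /= expr0n addr0 sqrtr_sqr.
by rewrite ltcR.
Qed.

Lemma sm_orth (A B : set K[i]) : borel A -> borel B -> A `&` B = set0 ->
  ip (E A x) (E B x) = 0.
Proof.
by move=> mA mB AB0; rewrite sm_selfadjoint// -sm_mul// AB0 sm_set0 linear0r.
Qed.

Let spectral_distribution0 : spectral_distribution set0 = 0%E.
Proof.
by rewrite /spectral_distribution sm_set0 /nrm normr0 expr0n.
Qed.

Let spectral_distribution_ge0 A : (0 <= spectral_distribution A)%E.
Proof. by rewrite lee_fin exprn_ge0// nrm_ge0. Qed.

Lemma sm_pythagoras (A : nat -> set K[i]) n :
  (forall i, borel (A i)) -> trivIset setT A ->
  nrm (\sum_(0 <= i < n) E (A i) x) ^+ 2 =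
  \sum_(0 <= i < n) nrm (E (A i) x) ^+ 2.
Proof.
move=> mA tA; elim: n => [|n IH].
  by rewrite !big_nil /nrm normr0 expr0n.
rewrite !big_nat_recr//= -IH.
have o : ip (\sum_(0 <= i < n) E (A i) x) (E (A n) x) = 0.
  rewrite linear_sumlz big_nat big1// => i /andP[_ ilt].
  apply: sm_orth => //; move/trivIsetP : tA; apply => //.
  by rewrite ltn_eqF.
have o' : ip (E (A n) x) (\sum_(0 <= i < n) E (A i) x) = 0.
  by rewrite hermC /= o rmorph0 mulr0.
apply: (@complexI K); rewrite rmorphD /= !nrm_sqr.
by rewrite linearDl !linearDr /= o o' addr0 add0r.
Qed.

Let spectral_distribution_sigma_additive :
  semi_sigma_additive spectral_distribution.
Proof.
move=> A mA tA _.
have h : nrm (\sum_(0 <= i < n) E (A i) x) @[n --> \oo] -->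
    nrm (E (\bigcup_i A i) x).
  by apply: cvg_nrm; exact: sm_sigma_additive.
have {}h := cvgM h h.
rewrite (_ : (fun n => _) =
    EFin \o (fun n => nrm (\sum_(0 <= i < n) E (A i) x) *
                      nrm (\sum_(0 <= i < n) E (A i) x))).
  rewrite /spectral_distribution expr2; apply: cvg_EFin; last exact: h.
  by near=> n.
by apply/funext => n /=; rewrite -expr2 sm_pythagoras// -sumEFin.
Unshelve. all: by end_near. Qed.

HB.instance Definition _ := isMeasure.Build _ (borelC K) K
  spectral_distribution spectral_distribution0 spectral_distribution_ge0
  spectral_distribution_sigma_additive.

End spectral_distribution.

Section spectral_expansion.
Context (K : realType) (H : completeNormedModType K[i]).
Context (ip : inner_product H) (E : spectral_measure ip).

(* The list [:: (c_1, A_1); ...; (c_n, A_n)] encodes the simple function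
   c_1 1_{A_1} + ... + c_n 1_{A_n}. *)
Definition simple (s : seq (K[i] * set K[i])) : Prop :=
  forall p, p \in s -> borel p.2.

Definition simple_fun (s : seq (K[i] * set K[i])) (z : K[i]) : K[i] :=
  \sum_(p <- s) p.1 * \1_(p.2) z.

Definition simple_int (s : seq (K[i] * set K[i])) (x : H) : H :=
  \sum_(p <- s) p.1 *: E p.2 x.

(* y = (\int phi dE) x: y is the limit in H of the integrals of simple functions
   tending to phi in L^2 of the measure (E(.)x, x). *)
Definition spectral_integral (phi : K[i] -> K[i]) (x y : H) : Prop :=
  exists s : nat -> seq (K[i] * set K[i]),
    [/\ forall n, simple (s n),
        (\int[spectral_distribution E x]_z
          (nrm (simple_fun (s n) z - phi z) ^+ 2)%:E)%E @[n --> \oo] --> 0%E &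
        simple_int (s n) x @[n --> \oo] --> y].

(* L = \int z dE(z), including the equality of the domains. *)
Definition resolution_of_identity (L : operator H) : Prop :=
  op_dom L = [set x | (\int[spectral_distribution E x]_z
                         (nrm (z : K[i]) ^+ 2)%:E < +oo)%E] /\
  forall x, op_dom L x -> spectral_integral id x (L x).

(* Literally TLf = LTf on Dom L \cap Dom(LT).  By itself this does not imply
   that T commutes with E: if Lu = cu, u <> 0, L is self-adjoint and v is not
   in Dom L, then it holds for Tf = (f, u)v, but E({c})Tu = |u|^2 E({c})v
   differs from TE({c})u = |u|^2 v.  The standard relation "TL is contained in
   LT" is the conjunction of [commutative_with T L] and
   [preserves_domain T L]. *)
Definition commutative_with (T : H -> H) (L : operator H) : Prop :=
  forall f, op_dom L f -> op_dom L (T f) -> T (L f) = L (T f).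

Definition preserves_domain (T : H -> H) (L : operator H) : Prop :=
  forall f, op_dom L f -> op_dom L (T f).

(* N and H are embedded in the linear space V by iN and iH. *)
Context (N : normedModType K[i]) (V : lmodType K[i]).
Context (iH : {linear H -> V}) (iN : {linear N -> V}).

Definition in_N (x : H) : Prop := exists n : N, iN n = iH x.

(* The norm in N of a vector of H belonging to N (irrelevant for others); iN is
   injective in all uses. *)
Definition norm_N (x : H) : K := nrm (xget 0 [set n : N | iN n = iH x]).

Definition bounded_op_N (T : H -> H) : Prop :=
  (forall x, in_N (T x)) /\ exists M : K, forall x, norm_N (T x) <= M * nrm x.

(* The norm of a bounded operator on H, its values being measured by [p]. *)
Definition op_norm (p : H -> K) (T : H -> H) : K :=
  sup [set p (T x) | x in [set x : H | nrm x <= 1]].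

Definition converges_unconditionally (f : H) : Prop :=
  (forall delta, borel delta -> in_N (E delta f)) /\
  forall eps : K, 0 < eps ->
    exists gamma : set K[i],
      [/\ borel gamma, exists lambda, gamma `<=` disk lambda &
          forall delta, borel delta -> gamma `<=` delta ->
            norm_N (f - E delta f) < eps].

End spectral_expansion.

(* Main.v *)
(* If R and S commute with every E(delta), then for f = R S g and
   h := (I - E(delta)) g = (I - E(delta)) h one has f - E(delta) f =
   R S (I - E(delta)) h, so the estimate holds with r_g(delta) := |h| / |g|, and
   r_g tends to 0 along disks by continuity from above of (E(.)g, g).

   That a bounded T with TL contained in LT commutes with E is Fuglede's theorem,
   proved here by Halmos' argument. If x is in the range of E(D), D a closed disk
   with center c and radius r, then |(L - c)^n T x| = |T (L - c)^n x| is at most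
   M r^n |x|, whereas |(L - c)^n y| >= q^n |y| for y in the range of E(A), A lying
   at distance q > r from c; hence E(A) T x = 0 and T maps the range of E(D) into
   itself. The Borel sets A such that T preserves the range of E(A) are stable under
   countable unions and intersections, so they include all open sets (unions of
   disks) and all closed sets (intersections of open sets). Those for which
   this holds together with their complement therefore form a sigma-algebra
   containing the open sets, and T preserving the ranges of both E(A) and I - E(A)
   means that T commutes with E(A). *)

Require Import Defs.
From HB Require Import structures.
From mathcomp Require Import all_boot all_order all_algebra.
From mathcomp Require Import complex.
From mathcomp Require Import all_classical all_reals all_analysis.
From mathcomp Require Import measurable_realfun ring lra.
Import Order.TTheory GRing.Theory Num.Theory numFieldNormedType.Exports.
Local Open Scope classical_set_scope.
Local Open Scope ring_scope.


Set Implicit Arguments.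
Unset Strict Implicit.
Unset Printing Implicit Defensive.

(** * The norm of complex normed spaces with real values *)

Section nrm_theory.
Context {K : realType}.

Lemma nrmC {U : normedZmodType K[i]} (x : U) : ((nrm x)%:C)%C = `|x|.
Proof.
have : 0 <= `|x| :> K[i] by [].
by rewrite /nrm; case: `|x| => a b; rewrite lecE /= => /andP[/eqP -> _].
Qed.

Lemma nrm_pos {U : normedZmodType K[i]} (x : U) : 0 <= nrm x.
Proof. by rewrite -lecR nrmC normr_ge0. Qed.

Lemma nrm0 {U : normedZmodType K[i]} : nrm (0 : U) = 0.
Proof. by rewrite /nrm normr0. Qed.

Lemma nrm_eq0 {U : normedZmodType K[i]} (x : U) : nrm x = 0 -> x = 0.
Proof. by move=> h; apply: normr0_eq0; rewrite -nrmC h. Qed.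

Lemma nrmN {U : normedZmodType K[i]} (x : U) : nrm (- x) = nrm x.
Proof. by rewrite /nrm normrN. Qed.

Lemma nrmD {U : normedZmodType K[i]} (x y : U) : nrm (x + y) <= nrm x + nrm y.
Proof. by rewrite -lecR rmorphD /= !nrmC ler_normD. Qed.

Lemma nrmZ {U : normedModType K[i]} (a : K[i]) (x : U) :
  nrm (a *: x) = nrm a * nrm x.
Proof. by apply: (@complexI K); rewrite rmorphM /= !nrmC normrZ. Qed.

Lemma nrm_real (a : K) : 0 <= a -> nrm ((a%:C)%C : K[i]) = a.
Proof.
by move=> a0; apply: (@complexI K); rewrite nrmC ger0_norm// lecR.
Qed.

Lemma nrm_ReIm (z : K[i]) : nrm z ^+ 2 = complex.Re z ^+ 2 + complex.Im z ^+ 2.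
Proof. by rewrite /nrm normc_def /= sqr_sqrtr// addr_ge0 ?sqr_ge0. Qed.

Lemma nrm_lt {U : normedZmodType K[i]} (x : U) (e : K) :
  (nrm x < e) = (`|x| < (e%:C)%C).
Proof. by rewrite -nrmC ltcR. Qed.

(** Balls of a normed space over [K[i]] have radii in [K[i]]; this passes to real radii, where real
    limits and squeezing apply. *)
Lemma cvg_nrmP {U : normedModType K[i]} (u : nat -> U) (l : U) :
  u @ \oo --> l <-> nrm (u n - l) @[n --> \oo] --> 0.
Proof.
split => h.
  apply/cvgrPdist_lt => e e0.
  have ec : 0 < (e%:C)%C :> K[i] by rewrite ltcR.
  move/cvgrPdist_lt : h => /(_ _ ec); apply: filterS => n.
  by rewrite -nrm_lt sub0r normrN ger0_norm ?nrm_pos// -nrmN opprB.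
apply/cvgrPdist_lt => e e0.
(* A positive element of [K[i]] is real, so [e] is determined by its real part. *)
have eE : ((complex.Re e)%:C)%C = e by apply: RRe_real; exact: gtr0_real.
have e1 : 0 < complex.Re e by rewrite -ltcR eE.
move/cvgrPdist_lt : h => /(_ _ e1); apply: filterS => n.
by rewrite sub0r normrN ger0_norm ?nrm_pos// nrm_lt eE distrC.
Qed.

(** The triangle inequality combined with Young's inequality 2ab <= e a^2 + b^2 / e, whose defect is
    e^-1 (e a - b)^2. *)
Lemma sqr_nrmD_le {U : normedZmodType K[i]} (e : K) (x y : U) : 0 < e ->
  nrm (x + y) ^+ 2 <= (1 + e) * nrm x ^+ 2 + (1 + e^-1) * nrm y ^+ 2.
Proof.
move=> e0; have h := nrmD x y.
have := nrm_pos (x + y); have := nrm_pos x; have := nrm_pos y.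
move: h; set a := nrm x; set b := nrm y; set c := nrm (x + y) => h b0 a0 c0.
apply: (@le_trans _ _ ((a + b) ^+ 2)); first by rewrite ler_sqr ?nnegrE ?addr_ge0.
rewrite -subr_ge0.
rewrite (_ : _ - _ = e^-1 * (e * a - b) ^+ 2); last by field; rewrite gt_eqF.
by rewrite mulr_ge0 ?sqr_ge0// invr_ge0 ltW.
Qed.

End nrm_theory.

(** * Continuity of bounded operators on [H] *)

Section hilbert.
Context {K : realType} {H : completeNormedModType K[i]}.

Lemma bounded_cvg (T : {linear H -> H}) (M : K) (u : nat -> H) (l : H) :
  (forall x, nrm (T x) <= M * nrm x) ->
  u @ \oo --> l -> T (u n) @[n --> \oo] --> T l.
Proof.
move=> TM /cvg_nrmP ul; apply/cvg_nrmP.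
have h : M * nrm (u n - l) @[n --> \oo] --> 0.
  by rewrite -[X in _ --> X](mulr0 M); apply: cvgMr.
apply: (squeeze_cvgr _ (cvg_cst 0) h).
by near=> n; rewrite nrm_pos -linearB TM.
Unshelve. all: by end_near. Qed.

End hilbert.

(** * Spectral measures *)

Section spectral_measure_theory.
Context {K : realType} {H : completeNormedModType K[i]}.
Context {ip : inner_product H} (E : spectral_measure ip).
Implicit Types (A B : set K[i]) (x : H).

Lemma borelT : @borel K setT. Proof. exact: measurableT. Qed.

Lemma borel_setC A : borel A -> borel (~` A).
Proof. exact: measurableC. Qed.

Lemma borel_setI A B : borel A -> borel B -> borel (A `&` B).
Proof. exact: measurableI. Qed.

Lemma sm_distribution A x : spectral_distribution E x A = (nrm (E A x) ^+ 2)%:E.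
Proof. by []. Qed.

(** Turns the vanishing of a projection into a null set, so that measure theory applies. *)
Lemma sm_eq0 A x : E A x = 0 <-> spectral_distribution E x A = 0%E.
Proof.
rewrite sm_distribution; split => [->|]; first by rewrite nrm0 expr0n.
by case=> /eqP; rewrite sqrf_eq0 => /eqP /nrm_eq0.
Qed.

(** The remainder [y] is annihilated by the projections of [A] and of its complement, so its
    spectral distribution has total mass 0 and [y] vanishes. *)
Lemma sm_setC A x : borel A -> E (~` A) x = x - E A x.
Proof.
move=> mA; have mcA := borel_setC mA.
pose y := x - E A x - E (~` A) x.
have yA : E A y = 0.
  rewrite /y !linearB /= -!sm_mul// setIid setICr sm_set0 subr0.
  by rewrite subrr.
have ycA : E (~` A) y = 0.
  rewrite /y !linearB /= -!sm_mul// setIid setICl sm_set0 subr0.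
  by rewrite subrr.
have : spectral_distribution E y setT = 0%E.
  rewrite -(setUv A).
  apply: (etrans (measureU (spectral_distribution E y) mA mcA (setICr A))).
  by rewrite /= !sm_distribution yA ycA nrm0 expr0n adde0.
move/sm_eq0; rewrite sm_setT /y => /eqP.
by rewrite subr_eq0 => /eqP ->.
Qed.

Lemma sm_contraction A x : borel A -> nrm (E A x) <= nrm x.
Proof.
move=> mA; rewrite -ler_sqr ?nnegrE ?nrm_pos//.
rewrite -lee_fin -sm_distribution -[in leRHS](sm_setT E x) -sm_distribution.
by apply: le_measure; rewrite ?inE//; exact: measurableT.
Qed.

Lemma sm_idem A x : borel A -> E A (E A x) = E A x.
Proof. by move=> mA; rewrite -sm_mul// setIid. Qed.

Lemma sm_comm A B x : borel A -> borel B -> E A (E B x) = E B (E A x).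
Proof. by move=> mA mB; rewrite -!sm_mul// setIC. Qed.

Lemma sm_fixP A x : borel A -> E A x = x <-> E (~` A) x = 0.
Proof.
move=> mA; rewrite sm_setC//; split => [->|/eqP]; first by rewrite subrr.
by rewrite subr_eq0 => /eqP.
Qed.

Lemma sm_fix_sub A B x : borel A -> borel B -> A `<=` B ->
  E A x = x -> E B x = x.
Proof. by move=> mA mB AB <-; rewrite -sm_mul// setIidr. Qed.

(** The complement of the intersection is a countable union of null sets of the distribution of
    [x]. *)
Lemma sm_fix_bigcap (A : nat -> set K[i]) x : (forall i, borel (A i)) ->
  (forall i, E (A i) x = x) -> E (\bigcap_i A i) x = x.
Proof.
move=> mA Ax; apply/sm_fixP; first exact: bigcapT_measurable.
apply/sm_eq0; rewrite setC_bigcap.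
apply: measure_negligible.
  by apply: bigcup_measurable => i _; exact: borel_setC.
apply: negligible_bigcup => i; apply/negligibleP; first exact: borel_setC.
by apply/sm_eq0/sm_fixP.
Qed.

Lemma sm_cvg A (u : nat -> H) (l : H) : borel A ->
  u @ \oo --> l -> E A (u n) @[n --> \oo] --> E A l.
Proof.
move=> mA; apply: (@bounded_cvg _ _ _ 1) => x.
by rewrite mul1r sm_contraction.
Qed.

End spectral_measure_theory.

(** * Measurability of complex functions *)

Section complex_measurability.
Context {K : realType}.
Local Notation T := (borelC K).

Lemma open_nrmP (U : set K[i]) :
  @open (K[i])^o U <->
  forall z, U z -> exists2 e : K, 0 < e & forall w, nrm (w - z) < e -> U w.
Proof.
rewrite openE; split => [oU z Uz|oU z /oU[e e0 eU]].
  have /nbhs_ballP[e /= e0 eU] := oU z Uz.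
  have eE : ((complex.Re e)%:C)%C = e by apply: RRe_real; exact: gtr0_real.
  exists (complex.Re e); first by rewrite -ltcR eE.
  by move=> w wz; apply: eU; rewrite -ball_normE /= distrC -eE -nrm_lt.
apply/nbhs_ballP; exists ((e%:C)%C); first by rewrite /= ltcR.
by move=> w; rewrite -ball_normE /= distrC -nrm_lt => /eU.
Qed.

Lemma open_borel (U : set K[i]) : @open (K[i])^o U -> borel U.
Proof. exact: sub_sigma_algebra. Qed.

(** Open intervals generate the Borel sets of [K], and their preimages under [f] are open. *)
Lemma measurable_lipschitz (f : K[i] -> K) :
  (forall z w, `|f z - f w| <= nrm (z - w)) ->
  measurable_fun [set: T] (f : T -> K).
Proof.
move=> fL; apply: (measurability _ (RGenOpens.measurableE K)).
move=> _ [_ [a [b ->] <-]]; rewrite setTI; apply: open_borel.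
apply/open_nrmP => z /=; rewrite in_itv /= => /andP[az zb].
exists (Num.min (f z - a) (b - f z)); first by rewrite lt_min !subr_gt0 az.
move=> w; rewrite lt_min => /andP[wa wb]; have := fL w z.
rewrite in_itv /= ler_distl => /andP[h1 h2].
by apply/andP; split; lra.
Qed.

Lemma measurable_Re : measurable_fun [set: T] (@complex.Re K : T -> K).
Proof.
apply: measurable_lipschitz => -[a b] [c d].
rewrite -ler_sqr ?nnegrE ?nrm_pos// nrm_ReIm real_normK ?num_real//=.
by rewrite lerDl sqr_ge0.
Qed.

Lemma measurable_Im : measurable_fun [set: T] (@complex.Im K : T -> K).
Proof.
apply: measurable_lipschitz => -[a b] [c d].
rewrite -ler_sqr ?nnegrE ?nrm_pos// nrm_ReIm real_normK ?num_real//=.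
by rewrite lerDr sqr_ge0.
Qed.

(** Working with real and imaginary parts reduces measurability to real functions; [nrm_ReIm] then
    covers the squared modulus. *)
Definition complex_measurable (f : K[i] -> K[i]) : Prop :=
  measurable_fun [set: T] (fun z : T => complex.Re (f z)) /\
  measurable_fun [set: T] (fun z : T => complex.Im (f z)).

Lemma complex_measurable_id : complex_measurable id.
Proof. by split; [exact: measurable_Re|exact: measurable_Im]. Qed.

Lemma complex_measurable_cst c : complex_measurable (fun=> c).
Proof. by split; exact: measurable_cst. Qed.

Lemma complex_measurableB f g : complex_measurable f -> complex_measurable g ->
  complex_measurable (fun z => f z - g z).
Proof.
move=> [f1 f2] [g1 g2]; split.
- under eq_fun do rewrite raddfB /=; exact: measurable_funB.
- under eq_fun do rewrite raddfB /=; exact: measurable_funB.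
Qed.

Lemma complex_measurable_simple (s : seq (K[i] * set K[i])) :
  simple s -> complex_measurable (simple_fun s).
Proof.
elim: s => [|p s ih] hs.
  have -> : simple_fun (K := K) [::] = fun=> 0.
    by apply/funext => z; rewrite /simple_fun big_nil.
  exact: complex_measurable_cst.
have -> : simple_fun (p :: s) =
    fun z => p.1 * \1_(p.2) z - - simple_fun s z.
  by apply/funext => z; rewrite opprK /simple_fun big_cons.
apply: complex_measurableB.
  have mp : borel p.2 by apply: hs; rewrite mem_head.
  have m1 : measurable_fun [set: T] (\1_(p.2 : set T) : T -> K).
    exact: measurable_indic.
  have pE (z : K[i]) : p.1 * \1_(p.2) z =
    ((complex.Re p.1 * \1_(p.2) z) +i* (complex.Im p.1 * \1_(p.2) z))%C.
    by rewrite !indicE; case: (_ \in _); rewrite /= !(mulr1, mulr0)//; case: p.1.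
  by split; under eq_fun do rewrite pE /=; exact: measurable_funM.
have -> : (fun z => - simple_fun s z) = (fun z => 0 - simple_fun s z).
  by apply/funext => z; rewrite sub0r.
apply: complex_measurableB; first exact: complex_measurable_cst.
by apply: ih => q qs; apply: hs; rewrite in_cons qs orbT.
Qed.

Lemma complex_measurable_sqr_nrm f : complex_measurable f ->
  measurable_fun [set: T] (fun z : T => (nrm (f z) ^+ 2)%:E).
Proof.
move=> [f1 f2]; apply/measurable_EFinP.
under eq_fun do rewrite nrm_ReIm.
by apply: measurable_funD; exact: measurable_funX.
Qed.

End complex_measurability.

(** * Isometry of the spectral integral *)

Section isometry.
Context {K : realType} {H : completeNormedModType K[i]}.
Context {ip : inner_product H} (E : spectral_measure ip).
Local Notation T := (borelC K).
Local Notation mu := (spectral_distribution E).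
Implicit Types (x : H) (s t : seq (K[i] * set K[i])).

(** The coefficients may be negative, so integrability is carried through the induction to make the
    integral additive. *)
Lemma mu_indic_sum x (s : seq (K * set K[i])) :
  (forall p, p \in s -> borel p.2) ->
  (mu x).-integrable [set: T]
    (fun z : T => (\sum_(p <- s) p.1 * \1_(p.2) z)%:E) /\
  (\int[mu x]_z (\sum_(p <- s) p.1 * \1_(p.2) z)%:E =
    (\sum_(p <- s) p.1 * nrm (E p.2 x) ^+ 2)%:E)%E.
Proof.
elim: s => [|p s ih] hs.
  under eq_fun do rewrite big_nil.
  by split; [exact: integrable0|rewrite integral0 big_nil].
have mp : borel p.2 by apply: hs; rewrite mem_head.
have {ih} [|i1 e1] := ih.
  by move=> q qs; apply: hs; rewrite in_cons qs orbT.
have i2 : (mu x).-integrable [set: T] (fun z : T => (\1_(p.2 : set T) z)%:E).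
  apply/integrableP; split; first by apply/measurable_EFinP; exact: measurable_indic.
  rewrite (_ : (fun _ => _) = (fun z : T => (\1_(p.2 : set T) z)%:E)).
    by rewrite integral_indic// setIT ltry.
  by apply/funext => z; rewrite gee0_abs// lee_fin indicE.
have e2 : (\int[mu x]_z (p.1%:E * (\1_(p.2 : set T) z)%:E) =
    (p.1 * nrm (E p.2 x) ^+ 2)%:E)%E.
  by rewrite integralZl// integral_indic// setIT.
have i3 := integrableZl measurableT p.1 i2.
under eq_fun do rewrite big_cons EFinD.
split; first exact: (integrableD measurableT i3 i1).
rewrite [in RHS]big_cons EFinD -e1 -e2 -integralD//.
Qed.

(** The projections are self-adjoint, idempotent and commute, so they can be moved between the two
    slots. *)
Lemma sm_ip A B x : borel A -> borel B ->
  ip (E A x) (E B x) = ((nrm (E (A `&` B) x) ^+ 2)%:C)%C.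
Proof.
move=> mA mB; rewrite (nrm_sqr ip) sm_mul//.
by rewrite [RHS]sm_selfadjoint// sm_idem// [in RHS]sm_comm//
  -[RHS]sm_selfadjoint// sm_idem// -!sm_selfadjoint// sm_comm.
Qed.

(** Both squares expand into the same double sum: by products of indicators on the left, by [sm_ip]
    on the right. *)
Lemma simple_int_isometry x s : simple s ->
  (\int[mu x]_z (nrm (simple_fun s z) ^+ 2)%:E =
    (nrm (simple_int E s x) ^+ 2)%:E)%E.
Proof.
move=> hs.
(* Terms of the expanded square; real parts of the coefficients suffice because the total is
   real. *)
pose t := [seq (complex.Re (p.1 * (q.1)^*), p.2 `&` q.2) | p <- s, q <- s].
have ht p : p \in t -> borel p.2.
  move=> /allpairsP[[a b] /= [sa sb ->]] /=.
  by apply: borel_setI; exact: hs.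
have [_ e] := mu_indic_sum x ht.
rewrite (_ : nrm (simple_int E s x) ^+ 2 =
    \sum_(p <- t) p.1 * nrm (E p.2 x) ^+ 2).
  rewrite -e; apply: eq_integral => z _; congr (_%:E).
  rewrite big_allpairs_dep/=.
  have -> : nrm (simple_fun s z) ^+ 2 =
      complex.Re (simple_fun s z * (simple_fun s z)^*).
    by rewrite -normCK -nrmC -rmorphXn.
  rewrite /simple_fun rmorph_sum mulr_suml raddf_sum/=; apply: eq_bigr => p _.
  rewrite mulr_sumr raddf_sum/=; apply: eq_bigr => q _.
  rewrite !indicE in_setI rmorphM/=.
  case: (z \in p.2); case: (z \in q.2);
    by rewrite /= ?rmorph1 ?rmorph0 ?(mulr0, mulr1, mul0r).
rewrite big_allpairs_dep/=.
have -> : nrm (simple_int E s x) ^+ 2 =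
    complex.Re (ip (simple_int E s x) (simple_int E s x)).
  by rewrite -(nrm_sqr ip).
rewrite /simple_int linear_sumlz raddf_sum/=.
rewrite big_seq [RHS]big_seq; apply: eq_bigr => p ps.
rewrite linear_sumr raddf_sum/=.
rewrite big_seq [RHS]big_seq; apply: eq_bigr => q qs.
rewrite linearZl_LR linearZr_LR/= sm_ip; [|exact: hs|exact: hs].
rewrite mulrA; case: (p.1 * _) => a b /=.
by rewrite mulr0 subr0.
Qed.

End isometry.

(** * Isometry and uniqueness for the spectral integral of the identity function *)

Section spectral_integral_theory.
Context {K : realType} {H : completeNormedModType K[i]}.
Context {ip : inner_product H} (E : spectral_measure ip).
Local Notation T := (borelC K).
Local Notation mu := (spectral_distribution E).
Implicit Types (x y : H) (s t : seq (K[i] * set K[i])).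

Lemma lee_mul_addgt0 (A B : \bar K) : (0 <= B)%E ->
  (forall e : K, 0 < e -> (A <= (1 + e)%:E * B)%E) -> (A <= B)%E.
Proof.
case: B => [b| |]; last 2 first.
- by move=> _ _; rewrite leey.
- by [].
rewrite lee_fin => b0 h; apply/lee_addgt0Pr => d d0.
(* The choice e = d / (b + 1) gives e b <= d, and the added 1 covers b = 0. *)
have b1 : 0 < b + 1 by rewrite ltr_wpDl.
apply: (le_trans (h (d / (b + 1)) _)); first exact: divr_gt0.
rewrite -EFinM -EFinD lee_fin mulrDl mul1r lerD2l.
by rewrite mulrAC ler_pdivrMr// ler_pM2l// lerDl.
Qed.

(* A substitute for Minkowski's inequality; the factor 1 + e is removed by
   [lee_mul_addgt0]. *)
Lemma integral_sqr_nrmD_le x (e : K) (f g h : K[i] -> K[i]) : 0 < e ->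
  complex_measurable f -> complex_measurable g -> complex_measurable h -> f =1 g \+ h ->
  (\int[mu x]_z (nrm (f z) ^+ 2)%:E <=
   (1 + e)%:E * \int[mu x]_z (nrm (g z) ^+ 2)%:E +
   (1 + e^-1)%:E * \int[mu x]_z (nrm (h z) ^+ 2)%:E)%E.
Proof.
move=> e0 mf mg mh fgh.
have e1 : 0 <= 1 + e by rewrite addr_ge0// ltW.
have e2 : 0 <= 1 + e^-1 by rewrite addr_ge0// invr_ge0 ltW.
have mg' := complex_measurable_sqr_nrm mg; have mh' := complex_measurable_sqr_nrm mh.
have p0 (k : K[i] -> K[i]) (z : T) : (0 <= (nrm (k z) ^+ 2)%:E)%E.
  by rewrite lee_fin sqr_ge0.
rewrite -!ge0_integralZl_EFin// -ge0_integralD//.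
- apply: ge0_le_integral => //; first exact: complex_measurable_sqr_nrm.
    by apply: emeasurable_funD; apply: measurable_funeM.
  by move=> z _; rewrite fgh -!EFinM -EFinD lee_fin sqr_nrmD_le.
- by move=> z _; rewrite mule_ge0 ?lee_fin ?sqr_ge0.
- exact: measurable_funeM.
- by move=> z _; rewrite mule_ge0 ?lee_fin ?sqr_ge0.
- exact: measurable_funeM.
Qed.

(** With concatenation as addition, this encodes differences of simple functions. *)
Definition simpleN s := [seq (- p.1, p.2) | p <- s].

Lemma simple_cat s t : simple s -> simple t -> simple (s ++ t).
Proof. by move=> hs ht p; rewrite mem_cat => /orP[/hs|/ht]. Qed.

Lemma simpleN_simple s : simple s -> simple (simpleN s).
Proof. by move=> hs _ /mapP[p /hs ? ->]. Qed.

Lemma simple_funB s t z :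
  simple_fun (s ++ simpleN t) z = simple_fun s z - simple_fun t z.
Proof.
rewrite /simple_fun big_cat big_map/= -sumrN; congr (_ + _).
by apply: eq_bigr => p _; rewrite mulNr.
Qed.

Lemma simple_intB s t x :
  simple_int E (s ++ simpleN t) x = simple_int E s x - simple_int E t x.
Proof.
rewrite /simple_int big_cat big_map/= -sumrN; congr (_ + _).
by apply: eq_bigr => p _; rewrite scaleNr.
Qed.

Lemma simple_intB_isometry x s t : simple s -> simple t ->
  (\int[mu x]_z (nrm (simple_fun s z - simple_fun t z) ^+ 2)%:E =
    (nrm (simple_int E s x - simple_int E t x) ^+ 2)%:E)%E.
Proof.
move=> hs ht; rewrite -simple_intB -simple_int_isometry; last first.
  by apply: simple_cat => //; exact: simpleN_simple.
by apply: eq_integral => z _; rewrite simple_funB.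
Qed.

Lemma cvg_sqr_nrmB (u : nat -> H) (l w : H) : u @ \oo --> l ->
  ((nrm (u n - w) ^+ 2)%:E @[n --> \oo] --> (nrm (l - w) ^+ 2)%:E)%E.
Proof.
move=> ul.
have h : nrm (u n - w) @[n --> \oo] --> nrm (l - w).
  by apply: cvg_nrm; apply: cvgB => //; exact: cvg_cst.
apply: cvg_EFin; first by near=> n.
by rewrite expr2; apply: cvgM.
Unshelve. all: by end_near. Qed.

(** Passage to the limit in [simple_intB_isometry]: each inequality is first proved up to a factor 1
    + e, the other term of the weighted triangle inequality tending to 0. *)
Lemma spectral_integral_isometry x y t : spectral_integral E id x y ->
  simple t ->
  (\int[mu x]_z (nrm ((z : K[i]) - simple_fun t z) ^+ 2)%:E =
    (nrm (y - simple_int E t x) ^+ 2)%:E)%E.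
Proof.
move=> [s [hs s0 sy]] ht.
have ms n := complex_measurable_simple (hs n); have mt := complex_measurable_simple ht.
have mid := @complex_measurable_id K.
have c1 := cvg_sqr_nrmB (w := simple_int E t x) sy.
(* Here [A] may be infinite; the sum of the limits is defined because the second one is 0. *)
have cD (c d : K) (A : \bar K) :
  ((c%:E * A + d%:E * \int[mu x]_z (nrm (simple_fun (s n) z - z) ^+ 2)%:E)
    @[n --> \oo] --> c%:E * A)%E.
  rewrite -[X in _ --> X]adde0; apply: cvgeD.
  - by rewrite fin_num_adde_defl.
  - exact: cvg_cst.
  - by rewrite -(mule0 d%:E); exact: cvgeZl.
(* Upper bound on the integral from z - t = (s_n - t) + (z - s_n), then the lower bound from s_n - t
   = (z - t) + (s_n - z). *)
apply/eqP; rewrite eq_le; apply/andP; split.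
- apply: lee_mul_addgt0; first by rewrite lee_fin sqr_ge0.
  move=> e e0.
  have c2 : ((1 + e)%:E * (nrm (simple_int E (s n) x - simple_int E t x) ^+ 2)%:E
      + (1 + e^-1)%:E * \int[mu x]_z (nrm (simple_fun (s n) z - z) ^+ 2)%:E
      @[n --> \oo] --> (1 + e)%:E * (nrm (y - simple_int E t x) ^+ 2)%:E)%E.
    rewrite -[X in _ --> X]adde0; apply: cvgeD.
    - by rewrite fin_num_adde_defl.
    - exact: cvgeZl.
    - by rewrite -(mule0 (1 + e^-1)%:E); exact: cvgeZl.
  apply: (cvge_to_ge c2); near=> n.
  rewrite -simple_intB_isometry//.
  have -> : (\int[mu x]_z (nrm (simple_fun (s n) z - z) ^+ 2)%:E =
      \int[mu x]_z (nrm ((z : K[i]) - simple_fun (s n) z) ^+ 2)%:E)%E.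
    by apply: eq_integral => z _; rewrite -nrmN opprB.
  apply: integral_sqr_nrmD_le => //; try exact: complex_measurableB.
  by move=> z /=; ring.
- apply: lee_mul_addgt0; first by apply: integral_ge0 => z _; rewrite lee_fin sqr_ge0.
  move=> e e0; apply: (lee_cvg_to c1 (cD _ (1 + e^-1) _)); near=> n.
  rewrite -simple_intB_isometry//.
  apply: integral_sqr_nrmD_le => //; try exact: complex_measurableB.
  by move=> z /=; ring.
Unshelve. all: by end_near. Qed.

(** By the isometry for [y], the approximants of [y'] are at distance tending to 0 from [y]. *)
Lemma spectral_integral_uniq x y y' : spectral_integral E id x y ->
  spectral_integral E id x y' -> y = y'.
Proof.
move=> xy [s [hs s0 sy']]; apply/eqP; rewrite -subr_eq0; apply/eqP.
apply: nrm_eq0; apply/eqP; rewrite -sqrf_eq0; apply/eqP.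
suff: (nrm (y - y') ^+ 2)%:E = 0%E by case.
have c1 := cvg_sqr_nrmB (w := y) sy'.
rewrite -nrmN opprB.
apply: (cvg_unique _ c1) => //.
apply: cvg_trans s0; apply: near_eq_cvg; near=> n.
rewrite -[in RHS]nrmN opprB -(spectral_integral_isometry xy)//.
by apply: eq_integral => z _; rewrite -nrmN opprB.
Unshelve. all: by end_near. Qed.

End spectral_integral_theory.

(** * The operator represented by a spectral measure *)

Section resolution.
Context {K : realType} {H : completeNormedModType K[i]}.
Context {ip : inner_product H} (E : spectral_measure ip) (L : operator H).
Context (hL : resolution_of_identity E L).
Local Notation T := (borelC K).
Local Notation mu := (spectral_distribution E).
Implicit Types (x y : H) (A B : set K[i]) (c : K[i]).

Lemma complex_measurable_sub c : complex_measurable (fun z : K[i] => z - c).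
Proof. by apply: complex_measurableB; [exact: complex_measurable_id|exact: complex_measurable_cst]. Qed.

(** The distribution of [E A x] is dominated by that of [x], so membership in the domain and the
    approximating simple functions carry over; uniqueness of the integral identifies the limit. *)
Lemma sm_commutes_op A x : borel A -> op_dom L x ->
  op_dom L (E A x) /\ L (E A x) = E A (L x).
Proof.
move=> mA Lx; have [domL intL] := hL.
have muA (B : set T) : measurable B -> (mu (E A x) B <= mu x B)%E.
  move=> mB; rewrite !sm_distribution lee_fin ler_sqr ?nnegrE ?nrm_pos//.
  by rewrite sm_comm// sm_contraction.
have intA f : complex_measurable f ->
    (\int[mu (E A x)]_z (nrm (f z) ^+ 2)%:E <=
     \int[mu x]_z (nrm (f z) ^+ 2)%:E)%E.
  move=> mf; apply: ge0_le_measure_integral => //.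
  - by move=> z; rewrite lee_fin sqr_ge0.
  - exact: complex_measurable_sqr_nrm.
have LAx : op_dom L (E A x).
  move: Lx; rewrite domL /= => Lx; apply: le_lt_trans Lx.
  exact: (intA id (@complex_measurable_id K)).
split => //; apply: (spectral_integral_uniq (intL _ LAx)).
have [s [hs s0 sL]] := intL _ Lx; exists s; split => //.
- apply: (squeeze_cvge _ (cvg_cst 0%E) s0); near=> n; apply/andP; split.
    by apply: integral_ge0 => z _; rewrite lee_fin sqr_ge0.
  by apply: intA; apply: complex_measurableB (@complex_measurable_id K); exact: complex_measurable_simple.
- have -> : (fun n => simple_int E (s n) (E A x)) =
      (fun n => E A (simple_int E (s n) x)).
    apply/funext => n; rewrite /simple_int raddf_sum/= big_seq [RHS]big_seq.
    apply: eq_bigr => p ps; rewrite linearZ/= sm_comm//; exact: hs ps.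
  exact: sm_cvg.
Unshelve. all: by end_near. Qed.

(** The complement of [A] is a null set of the distribution of [x]. *)
Lemma integral_concentrated A x f : borel A -> E A x = x -> complex_measurable f ->
  (\int[mu x]_z (nrm (f z) ^+ 2)%:E =
   \int[mu x]_(z in (A : set T)) (nrm (f z) ^+ 2)%:E)%E.
Proof.
move=> mA /(sm_fixP _ _ mA)/sm_eq0 A0 mf.
rewrite (ge0_negligible_integral (borel_setC mA))//=.
- by rewrite setDE setCK setTI.
- exact: complex_measurable_sqr_nrm.
- by move=> z _; rewrite lee_fin sqr_ge0.
Qed.

Lemma integral_cst_fix A x (r : K) : borel A -> E A x = x ->
  (\int[mu x]_(z in (A : set T)) (r%:E) = (r * nrm x ^+ 2)%:E)%E.
Proof. by move=> mA Ax; rewrite integral_cst//= sm_distribution Ax. Qed.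

Lemma integral_fix_le A x f (r : K) : borel A -> E A x = x ->
  complex_measurable f -> (forall z, A z -> nrm (f z) <= r) ->
  (\int[mu x]_z (nrm (f z) ^+ 2)%:E <= (r ^+ 2 * nrm x ^+ 2)%:E)%E.
Proof.
move=> mA Ax mf fr.
rewrite (integral_concentrated mA)// -(integral_cst_fix _ mA)//.
apply: ge0_le_integral => //.
- by move=> z _; rewrite lee_fin sqr_ge0.
- by apply: measurable_funS (complex_measurable_sqr_nrm mf).
- move=> z Az; rewrite lee_fin ler_sqr ?nnegrE ?nrm_pos ?fr//.
  exact: le_trans (nrm_pos _) (fr _ Az).
Qed.

Lemma integral_fix_ge A x f (r : K) : borel A -> E A x = x ->
  complex_measurable f -> 0 <= r -> (forall z, A z -> r <= nrm (f z)) ->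
  ((r ^+ 2 * nrm x ^+ 2)%:E <= \int[mu x]_z (nrm (f z) ^+ 2)%:E)%E.
Proof.
move=> mA Ax mf r0 fr.
rewrite (integral_concentrated mA)// -(integral_cst_fix _ mA)//.
apply: ge0_le_integral => //.
- by move=> z _; rewrite lee_fin sqr_ge0.
- by apply: measurable_funS (complex_measurable_sqr_nrm mf).
- by move=> z Az; rewrite lee_fin ler_sqr ?nnegrE ?nrm_pos ?fr.
Qed.

(** The isometry taken at the constant [c], encoded as [c] times the indicator of the plane. *)
Lemma op_sub_isometry c x : op_dom L x ->
  (\int[mu x]_z (nrm ((z : K[i]) - c) ^+ 2)%:E =
    (nrm (L x - c *: x) ^+ 2)%:E)%E.
Proof.
move=> Lx; have [_ /(_ _ Lx) intL] := hL.
have hs : simple [:: (c, [set: K[i]])].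
  by move=> p; rewrite inE => /eqP ->; exact: borelT.
have := spectral_integral_isometry intL hs.
rewrite /simple_int big_seq1/= sm_setT => <-; apply: eq_integral => z _.
by rewrite /simple_fun big_seq1/= indicT mulr1.
Qed.

(** On [A] the modulus of z is at most [r + nrm c], so the second moment is finite. *)
Lemma bounded_fix_dom A x c (r : K) : borel A -> E A x = x ->
  (forall z, A z -> nrm (z - c) <= r) -> op_dom L x.
Proof.
move=> mA Ax Ar; have [-> _] := hL => /=.
apply: (@le_lt_trans _ _ (((r + nrm c) ^+ 2 * nrm x ^+ 2)%:E)); last exact: ltry.
apply: (integral_fix_le mA Ax (@complex_measurable_id K)) => z Az.
rewrite -[X in nrm X](subrK c); apply: le_trans (nrmD _ _) _.
by rewrite lerD2r Ar.
Qed.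

Lemma op_sub_le A x c (r : K) : borel A -> E A x = x -> 0 <= r ->
  (forall z, A z -> nrm (z - c) <= r) -> nrm (L x - c *: x) <= r * nrm x.
Proof.
move=> mA Ax r0 Ar; have Lx := bounded_fix_dom mA Ax Ar.
rewrite -ler_sqr ?nnegrE ?mulr_ge0 ?nrm_pos// exprMn.
rewrite -lee_fin -op_sub_isometry//.
exact: (integral_fix_le mA Ax (complex_measurable_sub c) Ar).
Qed.

Lemma op_sub_ge A x c (r : K) : borel A -> E A x = x -> 0 <= r ->
  op_dom L x ->
  (forall z, A z -> r <= nrm (z - c)) -> r * nrm x <= nrm (L x - c *: x).
Proof.
move=> mA Ax r0 Lx Ar.
rewrite -ler_sqr ?nnegrE ?mulr_ge0 ?nrm_pos// exprMn.
rewrite -lee_fin -op_sub_isometry//.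
exact: (integral_fix_ge mA Ax (complex_measurable_sub c) r0 Ar).
Qed.

End resolution.

(** * Fuglede's theorem *)

Section fuglede.
Context {K : realType} {H : completeNormedModType K[i]}.
Context {ip : inner_product H} (E : spectral_measure ip) (L : operator H).
Context (hL : resolution_of_identity E L).
Context (T : {linear H -> H}) (M : K).
Context (TM : forall x, nrm (T x) <= M * nrm x).
Context (TL : commutative_with T L) (TdomL : preserves_domain T L).
Implicit Types (x y : H) (A B : set K[i]) (c : K[i]).

Definition cdisk c (r : K) : set K[i] := [set z | nrm (z - c) <= r].

Lemma borel_far c (r : K) : borel [set z : K[i] | r < nrm (z - c)].
Proof.
apply: open_borel; apply/open_nrmP => z /= rz.
exists (nrm (z - c) - r); first by rewrite subr_gt0.
move=> w wz; have := nrmD (z - w) (w - c).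
by rewrite subrKA -nrmN opprB in wz *; lra.
Qed.

Lemma borel_cdisk c (r : K) : borel (cdisk c r).
Proof.
rewrite (_ : cdisk c r = ~` [set z | r < nrm (z - c)]).
  by apply: borel_setC; exact: borel_far.
by apply/seteqP; split => z; rewrite /cdisk /= leNgt => /negP.
Qed.

(* On the range of the disk projection L - c has norm at most r, on that of E(A)
   it is bounded below by q, and both T and E(A) commute with it. *)
Lemma cdisk_far_decay c (r q : K) A n x : 0 <= r -> 0 < q -> borel A ->
  (forall z, A z -> q <= nrm (z - c)) ->
  E (cdisk c r) x = x -> q ^+ n * nrm (E A (T x)) <= M * r ^+ n * nrm x.
Proof.
move=> r0 q0 mA Aq; have mD := borel_cdisk c r.
elim: n x => [|n ih] x Dx.
  rewrite !expr0 mul1r mulr1; apply: le_trans (TM x).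
  exact: sm_contraction.
have Lx : op_dom L x := (bounded_fix_dom hL mD Dx (fun z h => h)).
have LTx := TdomL Lx.
have [LATx eA] := sm_commutes_op hL mA LTx.
have [_ eD] := sm_commutes_op hL mD Lx.
have TLx : T (L x - c *: x) = L (T x) - c *: T x.
  by rewrite linearB linearZ/= TL.
have h1 : q * nrm (E A (T x)) <= nrm (E A (T (L x - c *: x))).
  rewrite TLx linearB linearZ/= -eA.
  apply: (op_sub_ge hL mA) => //; first exact: sm_idem.
  exact: ltW.
have h2 : nrm (L x - c *: x) <= r * nrm x := (op_sub_le hL mD Dx r0 (fun z h => h)).
(* L - c keeps the range of the disk projection, so the induction hypothesis applies to the image of
   [x]. *)
have h3 : E (cdisk c r) (L x - c *: x) = L x - c *: x.
  by rewrite linearB linearZ/= -eD Dx.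
have h4 := ih _ h3; rewrite [q ^+ _]exprSr -mulrA.
apply: (@le_trans _ _ (M * r ^+ n * nrm (L x - c *: x))).
  by apply: le_trans h4; rewrite ler_pM2l// exprn_gt0.
(* The bound [M] has no prescribed sign; a negative one forces x = 0. *)
have [M0|M0] := leP 0 M.
  by rewrite exprSr (mulrA M) -[leRHS]mulrA ler_wpM2l// mulr_ge0// exprn_ge0.
have x0 : x = 0.
  apply: nrm_eq0; apply/eqP; rewrite eq_le nrm_pos andbT.
  have := le_trans (nrm_pos _) (TM x).
  by rewrite nmulr_rge0.
have -> : L x - c *: x = 0.
  apply: nrm_eq0; apply/eqP; rewrite eq_le nrm_pos andbT.
  by apply: le_trans h2 _; rewrite x0 nrm0 mulr0.
by rewrite x0 nrm0 !mulr0.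
Qed.

(** Dividing [cdisk_far_decay] by q^n leaves the factor (r / q)^n, which tends to 0. *)
Lemma cdisk_far_zero c (r q : K) A x : 0 <= r -> r < q -> borel A ->
  (forall z, A z -> q <= nrm (z - c)) ->
  E (cdisk c r) x = x -> E A (T x) = 0.
Proof.
move=> r0 rq mA Aq Dx; have q0 := le_lt_trans r0 rq.
apply: nrm_eq0; apply/eqP; rewrite eq_le nrm_pos andbT.
have c1 : (M * nrm x) * (r / q) ^+ n @[n --> \oo] --> 0.
  rewrite -[X in _ --> X](mulr0 (M * nrm x)); apply: cvgMr.
  apply: cvg_expr.
  by rewrite ger0_norm ?divr_ge0 ?(ltW q0)// ltr_pdivrMr// mul1r.
apply: (cvgr_to_ge c1); near=> n.
rewrite expr_div_n mulrA ler_pdivlMr ?exprn_gt0// [leLHS]mulrC [leRHS]mulrAC.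
exact: cdisk_far_decay r0 q0 mA Aq Dx.
Unshelve. all: by end_near. Qed.

(** The range of [E A] is its set of fixed vectors, so this is invariance of that range under
    [T]. *)
Definition invariant A := forall x, E A x = x -> E A (T x) = T x.

Lemma invariant_bigcap (A : nat -> set K[i]) : (forall i, borel (A i)) ->
  (forall i, invariant (A i)) -> invariant (\bigcap_i A i).
Proof.
move=> mA iA x Ax; apply: sm_fix_bigcap => // i; apply: iA.
apply: sm_fix_sub Ax => //; first exact: bigcapT_measurable.
exact: bigcap_inf.
Qed.

(** Splitting along the disjoint sets [seqDU A] makes [x] a series of vectors from the ranges of the
    [E (A i)]; continuity of [T] and of the projection passes invariance to the sum. *)
Lemma invariant_bigcup (A : nat -> set K[i]) : (forall i, borel (A i)) ->
  (forall i, invariant (A i)) -> invariant (\bigcup_i A i).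
Proof.
move=> mA iA x Ax.
have mU : borel (\bigcup_i A i) by exact: bigcupT_measurable.
have mB i : borel (seqDU A i).
  apply: (@measurableD _ (borelC K)); first exact: mA.
  by apply: bigsetU_measurable => j _; exact: mA.
have := @sm_sigma_additive _ _ _ E (seqDU A) x mB (trivIset_seqDU A).
rewrite -seqDU_bigcup_eq Ax => /(bounded_cvg TM) cT.
have cET := sm_cvg (E := E) mU cT.
apply: (cvg_unique _ cET) => //; apply: cvg_trans cT.
apply: near_eq_cvg; near=> n.
rewrite !linear_sum; apply: eq_bigr => i _.
apply: esym; apply: (sm_fix_sub (mA i) mU (@bigcup_sup _ _ _ _ _ I)); apply: iA.
apply: (sm_fix_sub (mB i) (mA i)); first exact: subDsetl.
exact: sm_idem.
Unshelve. all: by end_near. Qed.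

(** The exterior of the disk is exhausted by the sets [A k], each separated from it by the positive
    gap that [cdisk_far_zero] requires. *)
Lemma invariant_cdisk c (r : K) : 0 <= r -> invariant (cdisk c r).
Proof.
move=> r0 x Dx.
pose A (k : nat) := [set z : K[i] | r + k.+1%:R^-1 < nrm (z - c)].
have -> : cdisk c r = \bigcap_k (~` A k).
  apply/seteqP; split => z /=.
    move=> zr k _ /=; apply/negP; rewrite -leNgt; apply: le_trans zr _.
    by rewrite lerDl.
  move=> zA; rewrite /cdisk/=; apply/ler_addgt0Pr => e e0.
  have [k ke] := (ltr_add_invr e0).
  have /= /negP := zA k I; rewrite -leNgt => h; apply: (le_trans h).
  by rewrite lerD2l; move: ke; rewrite add0r => /ltW.
apply: sm_fix_bigcap => k; first by apply: borel_setC; exact: borel_far.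
apply/sm_fixP; first by apply: borel_setC; exact: borel_far.
rewrite setCK; apply: (@cdisk_far_zero c r (r + k.+1%:R^-1)) => //.
- by rewrite ltrDl invr_gt0.
- exact: borel_far.
- by move=> z /ltW.
Qed.

(** Disks with rational centers and radii 1/(k+1) suffice; those not inside [U] are replaced by the
    empty set, which keeps a single sequence. *)
Lemma open_bigcup_cdisk (U : set K[i]) : @open (K[i])^o U ->
  exists c : nat -> K[i], exists r : nat -> K,
    (forall n, 0 <= r n) /\
    U = \bigcup_n (if `[< cdisk (c n) (r n) `<=` U >]
                   then cdisk (c n) (r n) else set0).
Proof.
move=> /open_nrmP oU.
(* Numbers that code no triple get a default one, harmless since each disk is tested for inclusion
   in [U]. *)
pose d n : rat * rat * nat := odflt (0, 0, 0%N) (unpickle n).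
exists (fun n => ((ratr (d n).1.1) +i* (ratr (d n).1.2))%C).
exists (fun n => (d n).2.+1%:R^-1).
split; first by move=> n; rewrite invr_ge0.
apply/seteqP; split => [z /oU[e e0 eU]|z [n _]]; last first.
  by case: asboolP => // h /h.
(* With radius below e/2, a disk containing z stays in the e-ball around z. *)
have [k ke] := ltr_add_invr (divr_gt0 e0 (ltr0n K 2)).
move: ke; rewrite add0r => ke.
have k0 : 0 < k.+1%:R^-1 / 2 :> K by rewrite divr_gt0// invr_gt0.
have near_rat (v : K) : exists q : rat, ratr q \in `]v - k.+1%:R^-1 / 2, v + k.+1%:R^-1 / 2[.
  by apply: rat_in_itvoo; rewrite ltrD2l gt0_cp.
have [a] := near_rat (complex.Re z); rewrite in_itv/= => /andP[a1 a2].
have [b] := near_rat (complex.Im z); rewrite in_itv/= => /andP[b1 b2].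
have dn : d (pickle (a, b, k)) = (a, b, k) by rewrite /d pickleK.
exists (pickle (a, b, k)) => //; rewrite dn/=.
set c := (_ +i* _)%C.
have zc : nrm (z - c) <= k.+1%:R^-1.
  rewrite -ler_sqr ?nnegrE ?nrm_pos ?invr_ge0// nrm_ReIm.
  move: a1 a2 b1 b2 k0; rewrite /c; case: (z) => z1 z2 /=.
  set h := k.+1%:R^-1; set a' := ratr a; set b' := ratr b => a1 a2 b1 b2 k0.
  (* Each coordinate contributes at most h^2 / 4 to the squared distance. *)
  have p1 : 0 <= (h / 2 - (z1 - a')) * (h / 2 + (z1 - a')) by apply: mulr_ge0; lra.
  have p2 : 0 <= (h / 2 - (z2 - b')) * (h / 2 + (z2 - b')) by apply: mulr_ge0; lra.
  have := sqr_ge0 h; nra.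
case: asboolP => // -[] w wc; apply: eU.
have := nrmD (w - c) (c - z); rewrite subrKA -[nrm (c - z)]nrmN opprB.
move: wc; rewrite /cdisk/= => wc wz; apply: le_lt_trans wz _.
by rewrite [ltRHS]splitr; apply: ltr_leD; [exact: le_lt_trans ke|exact: ltW (le_lt_trans _ ke)].
Qed.

Lemma invariant_open (U : set K[i]) : @open (K[i])^o U -> invariant U.
Proof.
move=> /open_bigcup_cdisk[c [r [r0 ->]]].
apply: invariant_bigcup => n; case: asboolP => // _.
- exact: borel_cdisk.
- exact: measurable0.
- exact: invariant_cdisk.
- by move=> x; rewrite !sm_set0 => <-; rewrite linear0.
Qed.

(* A closed set is the intersection of its open 1/(n+1)-neighbourhoods. *)
Lemma invariant_setC_open (U : set K[i]) : @open (K[i])^o U -> invariant (~` U).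
Proof.
move=> oU.
pose V (n : nat) :=
  [set z : K[i] | exists2 w, ~ U w & nrm (z - w) < n.+1%:R^-1].
have oV n : @open (K[i])^o (V n).
  apply/open_nrmP => z [w Uw zw]; exists (n.+1%:R^-1 - nrm (z - w)).
    by rewrite subr_gt0.
  move=> y yz; exists w => //; have := nrmD (y - z) (z - w).
  by rewrite subrKA => /le_lt_trans; apply; rewrite -ltrBrDr.
have -> : ~` U = \bigcap_n V n.
  apply/seteqP; split => z /= hz.
    by move=> n _; exists z => //; rewrite subrr nrm0 invr_gt0.
  move/open_nrmP : oU => /[swap] Uz /(_ _ Uz)[e e0 eU].
  have [k] := ltr_add_invr e0; rewrite add0r => ke.
  have [w Uw zw] := hz k I; apply: Uw; apply: eU.
  by rewrite -nrmN opprB; exact: lt_trans zw ke.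
by apply: invariant_bigcap => n; [exact: open_borel|exact: invariant_open].
Qed.

(** Pairing each set with its complement makes the class closed under complements; for unions, the
    complements are handled by [invariant_bigcap]. *)
Lemma reducing_borel A : borel A -> invariant A /\ invariant (~` A).
Proof.
move=> mA.
suff : <<s @open (K[i])^o >> `<=`
    [set B | [/\ borel B, invariant B & invariant (~` B)]].
  by move=> /(_ A mA)[].
apply: smallest_sub; last first.
  move=> U oU; split; [exact: open_borel|exact: invariant_open|].
  exact: invariant_setC_open.
split.
- split; first exact: measurable0.
    by move=> x; rewrite !sm_set0 => <-; rewrite linear0.
  by rewrite setC0 => x _; rewrite sm_setT.
- move=> B [mB iB iCB]; rewrite setTD; split => //; last by rewrite setCK.
  exact: borel_setC.
- move=> B hB; split.
  + by apply: bigcupT_measurable => i; have [] := hB i.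
  + by apply: invariant_bigcup => i; have [] := hB i.
  + rewrite setC_bigcup; apply: invariant_bigcap => i; have [] := hB i => //.
    by move=> mB _ _; exact: borel_setC.
Qed.

Theorem fuglede A x : borel A -> T (E A x) = E A (T x).
Proof.
move=> mA; have [iA iCA] := reducing_borel mA.
have h1 : E A (T (E A x)) = T (E A x) by apply: iA; exact: sm_idem.
(* The range of the complementary projection is the kernel of [E A]. *)
have h2 : E A (T (E (~` A) x)) = 0.
  have mcA := borel_setC mA.
  have /(sm_fixP _ _ mcA) : E (~` A) (T (E (~` A) x)) = T (E (~` A) x).
    by apply: iCA; exact: sm_idem.
  by rewrite setCK.
have -> : T x = T (E A x) + T (E (~` A) x).
  by rewrite -linearD sm_setC// addrC subrK.
by rewrite linearD/= h1 h2 addr0.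
Qed.

End fuglede.

(** * Unconditional convergence *)

Section convergence.
Context {K : realType} {H : completeNormedModType K[i]}.
Context {ip : inner_product H} (E : spectral_measure ip).
Implicit Types (g x : H) (A B : set K[i]).

Lemma bounded_op_ge0 (T : H -> H) : bounded_op T ->
  exists2 M : K, 0 <= M & forall x, nrm (T x) <= M * nrm x.
Proof.
move=> [M TM]; exists `|M| => // x; apply: le_trans (TM x) _.
by rewrite ler_wpM2r ?nrm_pos// ler_norm.
Qed.

(** The bound [M] ensures that the supremum is taken over a set bounded above. *)
Lemma le_op_norm1 (p : H -> K) (T : H -> H) (M : K) :
  (forall x, p (T x) <= M * nrm x) ->
  forall x, nrm x <= 1 -> p (T x) <= op_norm p T.
Proof.
move=> TM x x1; apply: ub_le_sup; last by exists x.
exists `|M| => _ [y /= y1 <-]; apply: le_trans (TM y) _.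
apply: (@le_trans _ _ (`|M| * nrm y)); last by rewrite ler_piMr.
by rewrite ler_wpM2r ?nrm_pos// ler_norm.
Qed.

(** Rescaling to the unit ball. Homogeneity is asked of [p] only along [T], since [norm_N] is
    meaningful only at vectors of N. *)
Lemma le_op_norm (p : H -> K) (T : H -> H) (M : K) :
  (forall x, p (T x) <= M * nrm x) ->
  (forall (a : K) x, 0 <= a -> p (T ((a%:C)%C *: x)) = a * p (T x)) ->
  forall x, p (T x) <= op_norm p T * nrm x.
Proof.
move=> TM Th x.
have [x0|x0] := eqVneq (nrm x) 0.
  by apply: le_trans (TM x) _; rewrite x0 !mulr0.
have {}x0 : 0 < nrm x by rewrite lt_neqAle eq_sym x0 nrm_pos.
rewrite -ler_pdivrMr// mulrC -Th ?invr_ge0 ?nrm_pos//.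
apply: (le_op_norm1 TM).
by rewrite nrmZ nrm_real ?invr_ge0 ?nrm_pos// mulVf// gt_eqF.
Qed.

(** The tail beyond [B] is the projection of the tail beyond [A], and projections are
    contractions. *)
Lemma sm_tail_antitone A B g : borel A -> borel B -> A `<=` B ->
  nrm (g - E B g) <= nrm (g - E A g).
Proof.
move=> mA mB AB; rewrite -!sm_setC//.
have -> : ~` B = ~` B `&` ~` A by rewrite setIidl//; exact: subsetC.
rewrite sm_mul; [|exact: borel_setC|exact: borel_setC].
by apply: sm_contraction; exact: borel_setC.
Qed.

Lemma sm_tail_le A g : borel A -> nrm (g - E A g) <= nrm g.
Proof. by move=> mA; rewrite -sm_setC// sm_contraction//; exact: borel_setC. Qed.

Lemma borel_disk (l : K) : borel (disk l).
Proof.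
rewrite (_ : disk l = cdisk 0 l); first exact: borel_cdisk.
by apply/seteqP; split => z; rewrite /disk /cdisk /= subr0.
Qed.

(** Continuity from above of the distribution of [g] along disks of integer radius, extended to real
    radii by monotonicity. *)
Lemma sm_tail_cvg g : nrm (g - E (disk l) g) @[l --> +oo] --> (0 : K).
Proof.
have mC n : measurable ((~` disk (n%:R : K)) : set (borelC K)).
  by apply: borel_setC; exact: borel_disk.
have C0 : \bigcap_n (~` disk (n%:R : K)) = set0.
  rewrite -setC_bigcup -setCT; congr (~` _); apply/seteqP; split => // z _.
  exists (Num.truncn (nrm z)).+1 => //=; rewrite /disk/=.
  exact/ltW/truncnS_gt.
have := @nonincreasing_cvg_mu _ _ _ (spectral_distribution E g)
  (fun n => ~` disk (n%:R : K) : set (borelC K)).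
rewrite C0 measure0 => /(_ _ mC measurable0) h.
have {h} : (spectral_distribution E g (~` disk (n%:R : K)) @[n --> \oo] --> 0)%E.
  apply: h; first by rewrite /= sm_distribution ltry.
  apply/nonincreasing_seqP => n; apply/subsetPset; apply: subsetC => z.
  by rewrite /disk/= => /le_trans; apply; rewrite ler_nat.
move=> /fine_cvgP[_ /cvgrPdist_lt h].
apply/cvgrPdist_lt => e e0.
(* One integer radius is enough, as larger disks have smaller tails; e^2 appears because the measure
   is the squared norm. *)
have [n _ /(_ n (leqnn n))] := h (e ^+ 2) (exprn_gt0 2 e0).
rewrite /= sub0r normrN ger0_norm ?sqr_ge0//.
rewrite ltr_sqr ?nnegrE ?nrm_pos ?(ltW e0)// => ne.
near=> l; rewrite sub0r normrN ger0_norm ?nrm_pos//.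
apply: le_lt_trans ne; rewrite sm_setC; last exact: borel_disk.
apply: sm_tail_antitone; [exact: borel_disk|exact: borel_disk|].
move=> z; rewrite /disk/= => /le_trans; apply.
near: l; apply: nbhs_pinfty_ge; exact: num_real.
Unshelve. all: by end_near. Qed.

End convergence.

(** * The norm of N read on vectors of [H] *)

Section norm_N_theory.
Context {K : realType} {H : completeNormedModType K[i]}.
Context {N : normedModType K[i]} {V : lmodType K[i]}.
Context (iH : {linear H -> V}) (iN : {linear N -> V}).
Context (iN_inj : injective iN).

Lemma norm_NE x n : iN n = iH x -> norm_N iH iN x = nrm n.
Proof.
move=> nx; rewrite /norm_N; congr nrm; apply: xget_unique => // m mx.
by apply: iN_inj; rewrite mx.
Qed.

Lemma norm_NZ (a : K[i]) x : in_N iH iN x ->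
  norm_N iH iN (a *: x) = nrm a * norm_N iH iN x.
Proof.
move=> [n nx]; rewrite (norm_NE nx) -nrmZ; apply: norm_NE.
by rewrite !linearZ/= nx.
Qed.

Lemma norm_N_ge0 x : 0 <= norm_N iH iN x.
Proof. exact: nrm_pos. Qed.

End norm_N_theory.

Theorem theorem6p2 (K : realType) (H : completeNormedModType K[i])
    (ip : inner_product H) (E : spectral_measure ip) (L : operator H)
    (N : normedModType K[i]) (V : lmodType K[i])
    (iH : {linear H -> V}) (iN : {linear N -> V}) :
  separable H -> infinite_dimensional H ->
  normal_operator ip L -> unbounded L -> resolution_of_identity E L ->
  injective iH -> injective iN ->
  exists r : H -> set K[i] -> K,
    (forall g : H,
      [/\ forall delta, borel delta -> 0 <= r g delta <= 1,
          forall delta1 delta2, borel delta1 -> borel delta2 ->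
            delta1 `<=` delta2 -> r g delta2 <= r g delta1 &
          r g (disk lambda) @[lambda --> +oo] --> (0 : K)]) /\
    forall R S : {linear H -> H},
      bounded_op R -> bounded_op S ->
      commutative_with R L -> commutative_with S L ->
      preserves_domain R L -> preserves_domain S L ->
      bounded_op_N iH iN R ->
      (forall f, (exists g, f = R (S g)) ->
        converges_unconditionally E iH iN f) /\
      (forall f g delta, f = R (S g) -> borel delta ->
        norm_N iH iN (f - E delta f) <=
          op_norm (norm_N iH iN) R * nrm g *
          op_norm (@nrm K H) (fun x => S (x - E delta x)) * r g delta).
Proof.
move=> _ _ _ _ hL _ iN_inj.
(* The relative size of the tail of [g]; for g = 0 the quotient is 0, as the inverse of 0 is 0. *)
exists (fun g A => nrm (g - E A g) / nrm g); split.
  move=> g; split.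
  - move=> A mA; rewrite divr_ge0 ?nrm_pos//=.
    have [g0|g0] := eqVneq (nrm g) 0; first by rewrite g0 invr0 mulr0.
    by rewrite ler_pdivrMr ?mul1r ?sm_tail_le// lt_neqAle eq_sym g0 nrm_pos.
  - move=> A B mA mB AB; rewrite ler_wpM2r ?invr_ge0 ?nrm_pos//.
    exact: sm_tail_antitone.
  - by rewrite -[X in _ --> X](mul0r (nrm g)^-1); apply: cvgMl; exact: sm_tail_cvg.
move=> R S /bounded_op_ge0[MR MR0 RM] /bounded_op_ge0[MS MS0 SM].
move=> RL SL RdL SdL [R_N [M RNM]].
have RE A x : borel A -> R (E A x) = E A (R x) by exact: (fuglede hL RM).
have SE A x : borel A -> S (E A x) = E A (S x) by exact: (fuglede hL SM).
have diff A g : borel A ->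
    R (S g) - E A (R (S g)) = R (S (g - E A g)).
  by move=> mA; rewrite !linearB/= SE// RE.
split.
  move=> _ [g ->]; split; first by move=> A mA; rewrite -RE// -SE//; exact: R_N.
  move=> e e0.
  (* [C] bounds R S from [H] to N; [C + 1] is used as divisor because it is positive. *)
  pose C := `|M| * MS.
  have C1 : 0 < C + 1 by rewrite ltr_wpDl// mulr_ge0.
  have /cvgrPdist_lt /(_ _ (divr_gt0 e0 C1)) [l [_ lP]] := sm_tail_cvg E g.
  (* The limit at infinity speaks of radii strictly above [l]. *)
  have ll1 : l < l + 1 by rewrite ltrDl.
  have := lP _ ll1; rewrite sub0r normrN ger0_norm ?nrm_pos// => {lP ll1}.
  rewrite ltr_pdivlMr// => tail_lt.
  exists (disk (l + 1)); split; [exact: borel_disk|by exists (l + 1)|].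
  move=> A mA lA; rewrite diff//.
  apply: le_lt_trans tail_lt; apply: le_trans (RNM _) _.
  have le_tail := sm_tail_antitone E g (borel_disk _) mA lA.
  apply: (@le_trans _ _ (C * nrm (g - E A g))).
    rewrite /C -mulrA; apply: (@le_trans _ _ (`|M| * nrm (S (g - E A g)))).
      by rewrite ler_wpM2r ?nrm_pos// ler_norm.
    exact: ler_wpM2l.
  rewrite mulrC; apply: ler_pM => //; first exact: nrm_pos.
    by rewrite mulr_ge0.
  by rewrite lerDl.
move=> _ g A -> mA; rewrite diff//.
set h := g - E A g.
(* Since [h] is fixed by I - E(A), the norm of S(I - E(A)), and not just that of S, bounds S h. *)
have hh : h - E A h = h.
  by rewrite /h linearB/= sm_idem// subrr subr0.
have R_op x : norm_N iH iN (R x) <= op_norm (norm_N iH iN) R * nrm x.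
  apply: (le_op_norm RNM) => a y a0.
  by rewrite linearZ/= norm_NZ// nrm_real.
pose SA x := S (x - E A x).
have SA_le x : nrm (SA x) <= MS * nrm x.
  by apply: le_trans (SM _) _; rewrite ler_wpM2l// sm_tail_le.
have S_op : nrm (SA h) <= op_norm (@nrm K H) SA * nrm h.
  apply: (le_op_norm SA_le) => a y a0.
  by rewrite /SA linearZ/= -scalerBr linearZ/= nrmZ nrm_real.
(* This also holds for g = 0, because [h] then vanishes too. *)
have hr : nrm g * (nrm h / nrm g) = nrm h.
  have [g0|g0] := eqVneq (nrm g) 0; last by rewrite mulrC divfK.
  rewrite g0 mul0r; apply/esym/eqP; rewrite eq_le nrm_pos andbT -g0.
  exact: sm_tail_le.
have R_op_ge0 : 0 <= op_norm (norm_N iH iN) R.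
  apply: le_trans (le_op_norm1 RNM (x := 0) _); last by rewrite nrm0.
  exact: norm_N_ge0.
apply: le_trans (R_op _) _.
rewrite -!mulrA (mulrCA (nrm g)) hr.
by rewrite ler_wpM2l//; move: S_op; rewrite {1}/SA hh.
Qed.
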